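(* Let $d\ge2$ and suppose that $X_1$ and $X_2$ are two independent copies of a $d$-dimensional random vector $X\sim P$, where $P$ is symmetric about $\mu\in\mathbb{R}^d$. Then $P$ is spherically symmetric about $\mu$ if and only if the distribution of $X_1-X_2$ is spherically symmetric about the origin.
   Context: $P$ is symmetric about $\mu$ if $X-\mu\stackrel{D}{=}\mu-X$ for $X\sim P$. $P$ is spherically symmetric about $\mu$ if $H(X-\mu)\stackrel{D}{=}X-\mu$ for every $d\times d$ orthogonal matrix $H$; spherically symmetric about the origin is the case $\mu=0$. The paper assumes $d>1$ throughout. *)

(* Defs.v *)
From HB Require Import structures.
From mathcomp Require Import all_boot all_order all_algebra.
From mathcomp Require Import all_classical all_reals all_analysis.

Set Implicit Arguments.
Unset Strict Implicit.
Unset Printing Implicit Defensive.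

Import Order.TTheory GRing.Theory Num.Theory.
Import numFieldNormedType.Exports.

Local Open Scope classical_set_scope.
Local Open Scope ring_scope.

(* The Borel sigma-algebra of R^n, given (as the library does for
   [n.-tuple T]) as the product sigma-algebra: the smallest one making the n
   coordinate functions Borel measurable.  Thus a measurable function into
   ['cV[R]_n] is a vector of n real random variables. *)
Definition measure_cV_display : measure_display -> measure_display.
Proof. exact. Qed.

Section measurable_cV.
Context (R : realType) (n : nat).

Let coord (i : 'I_n) (x : 'cV[R]_n) : R := x i ord0.

Let cV_set0 : g_sigma_preimage coord set0.
Proof. exact: sigma_algebra0. Qed.

Let cV_setC A : g_sigma_preimage coord A -> g_sigma_preimage coord (~` A).
Proof. exact: sigma_algebraC. Qed.

Let cV_bigcup (F : _^nat) : (forall i, g_sigma_preimage coord (F i)) ->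
  g_sigma_preimage coord (\bigcup_i (F i)).
Proof. exact: sigma_algebra_bigcup. Qed.

HB.instance Definition _ :=
  @isMeasurable.Build (measure_cV_display default_measure_display)
    'cV[R]_n (g_sigma_preimage coord) cV_set0 cV_setC cV_bigcup.

End measurable_cV.

Lemma measurable_coord (R : realType) (n : nat) (i : 'I_n) :
  measurable_fun [set: 'cV[R]_n] (fun x => x i ord0).
Proof.
move=> _ Y mY; rewrite setTI; apply: sub_sigma_algebra => /=.
rewrite -bigcup_seq/=; exists i => /=; first by rewrite mem_index_enum.
by exists Y => //; rewrite setTI.
Qed.

Lemma measurable_fun_coordP d (T : measurableType d) (R : realType) (n : nat)
    (f : T -> 'cV[R]_n) :
  measurable_fun [set: T] f <->
  forall i, measurable_fun [set: T] (fun t => f t i ord0).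
Proof.
split=> [mf i|mf].
  exact: (measurableT_comp (measurable_coord i) mf).
move=> _ A mA.
suff : preimage_set_system [set: T] f measurable `<=` measurable.
  by apply; exists A.
rewrite /measurable/=.
rewrite -(g_sigma_preimage_comp (fun i (x : 'cV[R]_n) => x i ord0) f).
apply: smallest_sub; first exact: sigma_algebra_measurable.
case: n => [|n] in f mf A mA *; first by rewrite big_ord0.
rewrite -bigcup_mkord_ord; apply: bigcup_sub => i Ii.
by move=> B [C mC <-]; exact: mf.
Qed.

Section rv_sub.
Context d (T : measurableType d) (R : realType) (n : nat).
Variables X Y : {mfun T >-> 'cV[R]_n}.

Definition rv_sub : T -> 'cV[R]_n := fun t => X t - Y t.

Let measurable_rv_sub : measurable_fun [set: T] rv_sub.
Proof.
apply/measurable_fun_coordP => i.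
rewrite (_ : (fun t => _) = (fun t => X t i ord0) \- (fun t => Y t i ord0)).
  by apply: measurable_realfun.measurable_funB;
    apply: (measurable_fun_coordP _).1; exact: measurable_funPT.
by apply/funext => t; rewrite !mxE.
Qed.

HB.instance Definition _ :=
  isMeasurableFun.Build _ _ _ _ rv_sub measurable_rv_sub.

End rv_sub.

Definition eq_in_law d d' (T : measurableType d) (V : measurableType d')
    (R : realType) (P : probability T R) (X Y : T -> V) : Prop :=
  forall A : set V, measurable A -> P (X @^-1` A) = P (Y @^-1` A).

Definition has_law d d' (T : measurableType d) (V : measurableType d')
    (R : realType) (Pr : probability T R) (X : {RV Pr >-> V})
    (P : probability V R) : Prop :=
  forall A : set V, measurable A -> distribution Pr X A = P A.

Definition independent_rv d d' (T : measurableType d) (V : measurableType d')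
    (R : realType) (Pr : probability T R) (X Y : {RV Pr >-> V}) : Prop :=
  forall A B : set V, measurable A -> measurable B ->
    Pr (X @^-1` A `&` Y @^-1` B) = (Pr (X @^-1` A) * Pr (Y @^-1` B))%E.

Definition orthogonal_mx (R : realType) (n : nat) (H : 'M[R]_n) : Prop :=
  H^T *m H = 1%:M.

(* In the next two definitions the random vector [X ~ P] is the identity on
   the probability space [('cV[R]_n, P)]. *)
Definition symmetric_about (R : realType) (n : nat)
    (P : probability 'cV[R]_n R) (mu : 'cV[R]_n) : Prop :=
  eq_in_law P (fun x => x - mu) (fun x => mu - x).

Definition spherically_symmetric_about (R : realType) (n : nat)
    (P : probability 'cV[R]_n R) (mu : 'cV[R]_n) : Prop :=
  forall H : 'M[R]_n, orthogonal_mx H ->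
    eq_in_law P (fun x => H *m (x - mu)) (fun x => x - mu).

(* Main.v *)
(* Let phi t = E cos (t . (X - mu)); by symmetry it is the characteristic
   function of X - mu, and that of X1 - X2 is phi ^ 2.  By uniqueness of
   characteristic functions, spherical symmetry of either law means that its
   characteristic function is constant on spheres.  If phi ^ 2 is constant on
   spheres then so is phi: phi is continuous and even, and - t is joined to any
   s with |s| = |t| by a path in the sphere, along which phi cannot change sign.

   Uniqueness is proved by approximating the indicator of {y | a < y i} by
   bounded trigonometric polynomials: first 1_{u > 0} by polynomials in
   u = sin ((y i - a) / m), then letting m tend to infinity. *)
Require Import Defs.
From HB Require Import structures.
From mathcomp Require Import all_boot all_order all_algebra.
From mathcomp Require Import ring lra.
From mathcomp Require Import all_classical all_reals all_analysis.
From mathcomp Require Import measurable_realfun.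

Set Implicit Arguments.
Unset Strict Implicit.
Unset Printing Implicit Defensive.

Import Order.TTheory GRing.Theory Num.Theory.
Import numFieldNormedType.Exports.

Local Open Scope classical_set_scope.
Local Open Scope ring_scope.

(** * Integrals of bounded measurable functions *)

Section bounded_measurable.
Context d (T : measurableType d) (R : realType).
Implicit Types f g : T -> R.

(** These are the test functions of the whole proof: integrable against every probability, stable
    under products and bounded pointwise limits. *)
Definition bounded_measurable f : Prop :=
  measurable_fun [set: T] f /\ exists M, forall x, `|f x| <= M.

Lemma bounded_measurable_cst (c : R) : bounded_measurable (fun=> c).
Proof. by split; [exact: measurable_cst|exists `|c|]. Qed.

Lemma bounded_measurableD f g : bounded_measurable f -> bounded_measurable g ->
  bounded_measurable (fun x => f x + g x).
Proof.
move=> [mf [M fM]] [mg [N gN]]; split; first exact: measurable_funD.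
by exists (M + N) => x; rewrite (le_trans (ler_normD _ _))// lerD.
Qed.

Lemma bounded_measurableM f g : bounded_measurable f -> bounded_measurable g ->
  bounded_measurable (fun x => f x * g x).
Proof.
move=> [mf [M fM]] [mg [N gN]]; split; first exact: measurable_funM.
by exists (M * N) => x; rewrite normrM ler_pM.
Qed.

Lemma bounded_measurableZ (c : R) f : bounded_measurable f ->
  bounded_measurable (fun x => c * f x).
Proof. exact/bounded_measurableM/bounded_measurable_cst. Qed.

Lemma bounded_measurable_cos f : measurable_fun [set: T] f ->
  bounded_measurable (fun x => cos (f x)).
Proof.
move=> mf; split; last by exists 1 => x; exact: cos_max.
apply: measurableT_comp => //; apply: continuous_measurable_fun.
exact: continuous_cos.
Qed.

Lemma bounded_measurable_sin f : measurable_fun [set: T] f ->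
  bounded_measurable (fun x => sin (f x)).
Proof.
move=> mf; rewrite (_ : (fun x => _) = fun x => cos (f x - pi / 2)).
  exact/bounded_measurable_cos/measurable_funB.
by apply/funext => x; rewrite cosB cos_pihalf sin_pihalf mulr0 mulr1 add0r.
Qed.

Lemma bounded_measurable_limit (f_ : (T -> R)^nat) f (M : R) :
  (forall k, bounded_measurable (f_ k)) -> (forall k x, `|f_ k x| <= M) ->
  (forall x, f_ ^~ x @ \oo --> f x) -> bounded_measurable f.
Proof.
move=> bf fM cf; split.
  by apply: (@measurable_fun_cvg _ _ _ _ f_) => // k; exact: (bf k).1.
exists M => x.
by apply: (cvgr_to_le (cvg_norm (cf x))); exact: nearW.
Qed.

End bounded_measurable.

Lemma bounded_measurable_comp d d' (T : measurableType d) (V : measurableType d')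
    (R : realType) (f : V -> R) (X : T -> V) :
  bounded_measurable f -> measurable_fun [set: T] X ->
  bounded_measurable (fun t => f (X t)).
Proof.
move=> [mf [M fM]] mX; split; first exact: measurableT_comp.
by exists M.
Qed.

Section Rintegral_bounded_measurable.
Context d (T : measurableType d) (R : realType) (P : probability T R).
Implicit Types f g : T -> R.

Lemma integrable_bounded_measurable f : bounded_measurable f ->
  P.-integrable [set: T] (EFin \o f).
Proof.
move=> [mf [M fM]]; apply: measurable_bounded_integrable => //.
  exact: le_lt_trans (probability_le1 P measurableT) (ltry _).
by exists M; split; [exact: num_real|move=> N MN x _; exact: le_trans (ltW MN)].
Qed.

Lemma dominated_cvg_Rintegral (f_ : (T -> R)^nat) f (M : R) :
  (forall k, bounded_measurable (f_ k)) -> (forall k x, `|f_ k x| <= M) ->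
  (forall x, f_ ^~ x @ \oo --> f x) ->
  \int[P]_x f_ k x @[k --> \oo] --> \int[P]_x f x.
Proof.
move=> bf fM cf; have bmf := bounded_measurable_limit bf fM cf.
have [|||||_ _] := @dominated_convergence _ _ _ P setT measurableT
  (fun k => EFin \o f_ k) (EFin \o f) (cst M%:E).
- by move=> k; apply/measurable_EFinP; exact: (bf k).1.
- by apply/measurable_EFinP; exact: bmf.1.
- by apply: aeW => x _; exact: cvg_EFin (nearW _ _) (cf x).
- exact/(@integrable_bounded_measurable (cst M))/bounded_measurable_cst.
- by apply: aeW => x k _; rewrite lee_fin.
move=> h; apply: fine_cvg; rewrite fineK//.
by apply: integrable_fin_num => //; exact: integrable_bounded_measurable.
Qed.

End Rintegral_bounded_measurable.

(** * Expectations under equality in law and independence *)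

Lemma eq_in_law_Rintegral d d' (T : measurableType d) (V : measurableType d')
    (R : realType) (P : probability T R) (X Y : T -> V) (f : V -> R) :
  measurable_fun [set: T] X -> measurable_fun [set: T] Y ->
  eq_in_law P X Y -> bounded_measurable f ->
  \int[P]_x f (X x) = \int[P]_x f (Y x).
Proof.
move=> mX mY XY bf; have mf := bf.1.
have push (Z : T -> V) : measurable_fun [set: T] Z ->
    (\int[P]_x (f (Z x))%:E = \int[pushforward P Z]_y (f y)%:E)%E.
  move=> mZ; rewrite integral_pushforward ?preimage_setT//.
    exact/measurable_EFinP.
  exact/(@integrable_bounded_measurable _ _ _ _ (f \o Z))/bounded_measurable_comp.
rewrite /Rintegral !push//; congr fine.
by apply: eq_measure_integral => A mA _; exact: XY.
Qed.

Lemma distribution_Rintegral d d' (T : measurableType d) (V : measurableType d')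
    (R : realType) (Pr : probability T R) (X : {RV Pr >-> V}) (f : V -> R) :
  bounded_measurable f ->
  \int[distribution Pr X]_y f y = \int[Pr]_x f (X x).
Proof.
move=> bf; rewrite /Rintegral integral_distribution//.
  by apply/measurable_EFinP; case: bf.
exact/(@integrable_bounded_measurable _ _ _ _ (f \o X))/bounded_measurable_comp.
Qed.

Lemma has_law_Rintegral d d' (T : measurableType d) (V : measurableType d')
    (R : realType) (Pr : probability T R) (X : {RV Pr >-> V})
    (P : probability V R) (f : V -> R) :
  has_law X P -> bounded_measurable f ->
  \int[Pr]_x f (X x) = \int[P]_y f y.
Proof.
move=> XP bf; rewrite -distribution_Rintegral//; congr fine.
by apply: eq_measure_integral => A mA _; exact: XP.
Qed.

(** Independence says that the joint law and the product of the marginal laws agree on rectangles,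
    hence everywhere; Fubini's theorem then splits the integral. *)
Lemma independent_Rintegral d d' (T : measurableType d) (V : measurableType d')
    (R : realType) (Pr : probability T R) (X Y : {RV Pr >-> V}) (f g : V -> R) :
  independent_rv X Y -> bounded_measurable f -> bounded_measurable g ->
  \int[Pr]_x (f (X x) * g (Y x)) = \int[Pr]_x f (X x) * \int[Pr]_x g (Y x).
Proof.
move=> indXY bf bg.
have mXY : measurable_fun [set: T] (fun x => (X x, Y x)).
  by apply: measurable_fun_pair; exact: measurable_funPT.
pose XY : {mfun T >-> (V * V)%type} :=
  MeasurableFun.Pack (MeasurableFun.Class (isMeasurableFun.Build _ _ _ _ _ mXY)).
pose PX := distribution Pr X; pose PY := distribution Pr Y.
pose h (z : V * V) : R := f z.1 * g z.2.
have bh : bounded_measurable h.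
  by apply: bounded_measurableM; apply: bounded_measurable_comp.
have prodE A : measurable A -> (PX \x PY)%E A = distribution Pr XY A.
  apply: product_measure_unique => B C mB mC; exact: indXY.
have -> : \int[Pr]_x (f (X x) * g (Y x)) = \int[(PX \x PY)%E]_z h z.
  rewrite /Rintegral.
  rewrite (@eq_measure_integral _ _ _ _ (distribution Pr XY)) => [|A mA _].
    rewrite integral_distribution//; first by apply/measurable_EFinP; case: bh.
    exact/(@integrable_bounded_measurable _ _ _ _ (h \o XY))/bounded_measurable_comp.
  exact: prodE.
rewrite -(distribution_Rintegral X)// -(distribution_Rintegral Y)//.
rewrite -RintegralZr//;
  last exact: (@integrable_bounded_measurable _ _ _ PX).
rewrite [LHS]/Rintegral -integral12_prod_meas1; last first.
  exact: (@integrable_bounded_measurable _ _ _ (PX \x PY)%E).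
congr fine; apply: eq_integral => x _; rewrite /fubini_F /h/=.
under eq_integral do rewrite EFinM.
rewrite integralZl//; last exact: (@integrable_bounded_measurable _ _ _ PY).
rewrite EFinM fineK// integrable_fin_num//.
exact: (@integrable_bounded_measurable _ _ _ PY).
Qed.

(** * Polynomial approximation of the step function *)

Section step_function.
Context (R : realType).
Implicit Types x y u v z : R.

Lemma bernoulli_inequality y n : 0 <= y -> 1 + n%:R * y <= (1 + y) ^+ n.
Proof.
move=> y0; elim: n => [|n ih]; first by rewrite mul0r addr0 expr0.
rewrite exprS (le_trans _ (ler_wpM2l _ ih)) ?addr_ge0//.
have : 0 <= n%:R * y * y by rewrite !mulr_ge0.
by rewrite -natr1; lra.
Qed.

Lemma bernoulli_inequalityN y n : 0 <= y <= 1 -> 1 - n%:R * y <= (1 - y) ^+ n.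
Proof.
move=> /andP[y0 y1]; elim: n => [|n ih]; first by rewrite mul0r subr0 expr0.
rewrite exprS (le_trans _ (ler_wpM2l _ ih)) ?subr_ge0//.
have : 0 <= n%:R * y * y by rewrite !mulr_ge0.
by rewrite -natr1; lra.
Qed.

(** Since [(1 - y) * (1 + y) = 1 - y ^+ 2 <= 1], the left side is at most the inverse of
    [(1 + y) ^+ n], to which Bernoulli's inequality applies. *)
Lemma exprN_bernoulli y n : 0 <= y <= 1 -> (1 - y) ^+ n <= (1 + n%:R * y)^-1.
Proof.
move=> /andP[y0 y1]; have ny0 : 0 < 1 + n%:R * y by rewrite ltr_pwDl// mulr_ge0.
rewrite -[leRHS]mul1r ler_pdivlMr//.
rewrite (le_trans (ler_wpM2l _ (bernoulli_inequality n y0))) ?exprn_ge0 ?subr_ge0//.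
rewrite -exprMn exprn_ile1//; last by rewrite -subr_sqr expr1n gerBl sqr_ge0.
by rewrite mulr_ge0 ?subr_ge0 ?addr_ge0.
Qed.

(** The second factor is known from elementary proofs of the Stone-Weierstrass theorem: it tends to
    a step that jumps at [u = 0]. At the jump itself its limit is 1/e; the factor [u] makes the
    limit there [0] and turns the step into the positive part. *)
Definition step_poly n u : R := u * (1 - ((1 - u) / 2) ^+ n) ^+ (2 ^ n).

Lemma normr_step_poly n u : `|u| <= 1 -> `|step_poly n u| <= 1.
Proof.
rewrite ler_norml => /andP[uN1 u1]; rewrite normrM normrX mulr_ile1//.
  by rewrite ler_norml uN1.
rewrite exprn_ile1// ger0_norm ?gerBl ?exprn_ge0 ?subr_ge0 ?exprn_ile1//; lra.
Qed.

(* With x = (1 - u) / 2, the factor (1 - x ^+ n) ^+ (2 ^ n) tends to 1 if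
   2 x < 1 and to 0 if 2 x > 1, by Bernoulli's inequality. *)
Lemma cvg_step_poly u : `|u| <= 1 ->
  step_poly n u @[n --> \oo] --> Num.max u 0.
Proof.
rewrite ler_norml => /andP[uN1 u1]; rewrite /step_poly.
pose x := (1 - u) / 2; have x0 : 0 <= x by rewrite /x; lra.
have x1 : x <= 1 by rewrite /x; lra.
have xn n : 0 <= x ^+ n <= 1 by rewrite exprn_ge0// exprn_ile1.
have [u0|u0|->] := ltrgt0P u; last first.
- rewrite (_ : (fun n => _) = cst 0); first exact: cvg_cst.
  by apply/funext => n; rewrite mul0r.
- rewrite -[X in _ --> X](mulr0 u); apply: cvgM; first exact: cvg_cst.
  apply: (@squeeze_cvgr _ _ _ _ (cst 0) (fun n => (2 * x)^-1 ^+ n)).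
  + apply: nearW => n; rewrite exprn_ge0 ?subr_ge0; last by case/andP: (xn n).
    rewrite (le_trans (exprN_bernoulli _ (xn n)))// natrX -exprMn exprVn lef_pV2//.
    * by rewrite lerDr.
    * by rewrite posrE ltr_pwDl// exprn_ge0// mulr_ge0.
    * by rewrite posrE exprn_gt0// mulr_gt0// /x; lra.
  + exact: cvg_cst.
  + have x2 : 1 < 2 * x by rewrite /x; lra.
    by apply: cvg_expr; rewrite ger0_norm ?invr_ge0 ?invf_lt1//; lra.
- rewrite -[X in _ --> X](mulr1 u); apply: cvgM; first exact: cvg_cst.
  apply: (@squeeze_cvgr _ _ _ _ (fun n => 1 - (2 * x) ^+ n) (cst 1)).
  + apply: nearW => n; apply/andP; split.
      by rewrite exprMn -natrX bernoulli_inequalityN.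
    by rewrite exprn_ile1// ?subr_ge0 ?gerBl; case/andP: (xn n).
  + rewrite -[X in _ --> X]subr0; apply: cvgB; first exact: cvg_cst.
    by apply: cvg_expr; rewrite ger0_norm /x; lra.
  + exact: cvg_cst.
Qed.

(** Applied to the positive part of a sine, this second limit yields the indicator of the set where
    the sine is positive. *)
Lemma cvg_onem_expr v : 0 <= v <= 1 ->
  1 - (1 - v) ^+ n @[n --> \oo] --> ((0 < v)%R%:R : R).
Proof.
move=> /andP[v0 v1]; have [vgt0|] := ltrP 0 v.
  rewrite -[X in _ --> X]subr0; apply: cvgB; first exact: cvg_cst.
  by apply: cvg_expr; rewrite ger0_norm ?subr_ge0// gtrBl.
move=> vle0; rewrite (_ : (fun n => _) = cst 0); first exact: cvg_cst.
have -> : v = 0 by apply/eqP; rewrite eq_le vle0.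
by apply/funext => n; rewrite subr0 expr1n subrr.
Qed.

Lemma sin_gt0_near0 z : `|z| < pi -> (0 < sin z) = (0 < z).
Proof.
rewrite ltr_norml => /andP[zNpi zpi].
have [z0|z0|->] := ltrgt0P z; last by rewrite sin0 ltxx.
- by rewrite sin_gt0_pi// z0.
- apply/negbTE; rewrite -leNgt -oppr_ge0 -sinN ltW// sin_gt0_pi// oppr_gt0 z0.
  by rewrite ltrNl.
Qed.

(** The sequence is eventually constant: once [n.+1] exceeds [|z| / pi], the angle lies in the
    interval around 0 where sine has the sign of its argument. *)
Lemma cvg_sin_gt0 z :
  (0 < sin (z / n.+1%:R))%R%:R @[n --> \oo] --> ((0 < z)%R%:R : R).
Proof.
apply: cvg_near_cst; exists (Num.truncn (`|z| / pi)) => // n /= nz.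
rewrite sin_gt0_near0.
  by rewrite pmulr_lgt0// invr_gt0.
rewrite normrM normfV [X in _ / X]ger0_norm// ltr_pdivrMr// mulrC.
rewrite -ltr_pdivrMr ?pi_gt0// (lt_le_trans (truncnS_gt _))//.
by rewrite ler_nat.
Qed.

End step_function.

(** * Uniqueness of characteristic functions *)

Section dotmul.
Context (R : realType) (n : nat).
Implicit Types u v w : 'cV[R]_n.

Definition dotmul u v : R := (u^T *m v) ord0 ord0.

Lemma dotmulE u v : dotmul u v = \sum_i u i ord0 * v i ord0.
Proof. by rewrite /dotmul mxE; apply: eq_bigr => i _; rewrite mxE. Qed.

Lemma dotmulC u v : dotmul u v = dotmul v u.
Proof. by rewrite !dotmulE; apply: eq_bigr => i _; rewrite mulrC. Qed.

Lemma dotmulDl u v w : dotmul (u + v) w = dotmul u w + dotmul v w.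
Proof. by rewrite /dotmul linearD/= mulmxDl mxE. Qed.

Lemma dotmulDr u v w : dotmul u (v + w) = dotmul u v + dotmul u w.
Proof. by rewrite /dotmul mulmxDr mxE. Qed.

Lemma dotmulNl u v : dotmul (- u) v = - dotmul u v.
Proof. by rewrite /dotmul linearN/= mulNmx mxE. Qed.

Lemma dotmulNr u v : dotmul u (- v) = - dotmul u v.
Proof. by rewrite /dotmul mulmxN mxE. Qed.

Lemma dotmulBl u v w : dotmul (u - v) w = dotmul u w - dotmul v w.
Proof. by rewrite dotmulDl dotmulNl. Qed.

Lemma dotmulBr u v w : dotmul u (v - w) = dotmul u v - dotmul u w.
Proof. by rewrite dotmulDr dotmulNr. Qed.

Lemma dotmulZl a u v : dotmul (a *: u) v = a * dotmul u v.
Proof. by rewrite /dotmul linearZ/= -scalemxAl mxE. Qed.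

Lemma dotmulZr a u v : dotmul u (a *: v) = a * dotmul u v.
Proof. by rewrite /dotmul -scalemxAr mxE. Qed.

Lemma dotmul0l v : dotmul 0 v = 0.
Proof. by rewrite /dotmul linear0 mul0mx mxE. Qed.

Lemma dotmul_tr (H : 'M[R]_n) u v : dotmul u (H *m v) = dotmul (H^T *m u) v.
Proof. by rewrite /dotmul trmx_mul trmxK mulmxA. Qed.

Lemma dotmul_delta i v : dotmul (delta_mx i ord0) v = v i ord0.
Proof.
rewrite dotmulE (bigD1 i)//= mxE !eqxx mul1r big1 ?addr0// => j ji.
by rewrite mxE (negbTE ji) mul0r.
Qed.

Lemma dotmul_eq0 u : (dotmul u u == 0) = (u == 0).
Proof.
apply/idP/eqP => [|->]; last by rewrite dotmul0l.
rewrite dotmulE psumr_eq0 => [/allP u0|i _]; last by rewrite -expr2 sqr_ge0.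
apply/colP => i; rewrite mxE; apply/eqP.
by have := u0 i (mem_index_enum _); rewrite -expr2 sqrf_eq0.
Qed.

Lemma measurable_dotmul u : measurable_fun [set: 'cV[R]_n] (dotmul u).
Proof.
rewrite (_ : dotmul u = fun v => \sum_i u i ord0 * v i ord0).
  apply: measurable_sum => i; apply: measurable_funM => //.
  exact: measurable_coord.
by apply/funext => v; rewrite dotmulE.
Qed.

End dotmul.

Section uniqueness.
Context d (T : measurableType d) (R : realType) (n : nat).
Variables (P : probability T R) (X Y : T -> 'cV[R]_n).
Hypotheses (mX : measurable_fun [set: T] X) (mY : measurable_fun [set: T] Y).

(* The functions that integrate alike against X and Y, together with all their
   modulations.  Their multipliers form an algebra closed under bounded
   pointwise limits; it contains the indicators of half-spaces, hence of all
   Borel sets. *)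
Let agree (f : 'cV[R]_n -> R) : Prop := bounded_measurable f /\
  forall s theta, \int[P]_x (f (X x) * cos (dotmul s (X x) + theta)) =
                  \int[P]_x (f (Y x) * cos (dotmul s (Y x) + theta)).

(** The class [agree] is not evidently closed under products, whereas multipliers can be applied one
    after the other. *)
Let multiplier (h : 'cV[R]_n -> R) : Prop := bounded_measurable h /\
  forall f, agree f -> agree (fun x => h x * f x).

Let bm_cos s theta :
  bounded_measurable (fun x : 'cV[R]_n => cos (dotmul s x + theta)).
Proof.
apply: bounded_measurable_cos; apply: measurable_funD => //.
exact: measurable_dotmul.
Qed.

Let integrable_agree f s theta (Z : T -> 'cV[R]_n) : measurable_fun [set: T] Z ->
  bounded_measurable f ->
  P.-integrable [set: T]
    (EFin \o (fun x => f (Z x) * cos (dotmul s (Z x) + theta))).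
Proof.
move=> mZ bf; apply: integrable_bounded_measurable.
exact: (bounded_measurable_comp (bounded_measurableM bf (bm_cos s theta))).
Qed.

Let agreeD f g : agree f -> agree g -> agree (fun x => f x + g x).
Proof.
move=> [bf fXY] [bg gXY]; split=> [|s theta]; first exact: bounded_measurableD.
have H Z : measurable_fun [set: T] Z ->
    \int[P]_x ((f (Z x) + g (Z x)) * cos (dotmul s (Z x) + theta)) =
    \int[P]_x (f (Z x) * cos (dotmul s (Z x) + theta)) +
    \int[P]_x (g (Z x) * cos (dotmul s (Z x) + theta)).
  move=> mZ; rewrite -RintegralD//; [|exact: integrable_agree..].
  by apply: eq_Rintegral => x _; rewrite mulrDl.
by rewrite !H// fXY gXY.
Qed.

Let agreeZ c f : agree f -> agree (fun x => c * f x).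
Proof.
move=> [bf fXY]; split=> [|s theta]; first exact: bounded_measurableZ.
have H Z : measurable_fun [set: T] Z ->
    \int[P]_x (c * f (Z x) * cos (dotmul s (Z x) + theta)) =
    c * \int[P]_x (f (Z x) * cos (dotmul s (Z x) + theta)).
  move=> mZ; rewrite -RintegralZl//; last exact: integrable_agree.
  by apply: eq_Rintegral => x _; rewrite mulrA.
by rewrite !H// fXY.
Qed.

Let agree_limit (f_ : ('cV[R]_n -> R)^nat) f M :
  (forall k, agree (f_ k)) -> (forall k x, `|f_ k x| <= M) ->
  (forall x, f_ ^~ x @ \oo --> f x) -> agree f.
Proof.
move=> af fM cf; have bf k : bounded_measurable (f_ k) by case: (af k).
split=> [|s theta]; first exact: bounded_measurable_limit bf fM cf.
have H Z : measurable_fun [set: T] Z ->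
    \int[P]_x (f_ k (Z x) * cos (dotmul s (Z x) + theta)) @[k --> \oo] -->
    \int[P]_x (f (Z x) * cos (dotmul s (Z x) + theta)).
  move=> mZ; apply: (@dominated_cvg_Rintegral _ _ _ _ _ _ M) => [k|k x|x].
  - exact: (bounded_measurable_comp (bounded_measurableM (bf k) (bm_cos s theta))).
  - by rewrite normrM -[M]mulr1 ler_pM// cos_max.
  - by apply: cvgM; [exact: cf|exact: cvg_cst].
have := H _ mX; under eq_cvg do rewrite (af _).2.
by move=> /cvg_unique; apply => //; exact: H.
Qed.

(** The product of two cosines is half the sum of the cosines of the sum and the difference of the
    angles, so only modulations by [s + t] and [s - t] arise. This is why [agree] ranges over all
    frequencies and phases. *)
Let agree_cos s theta f : agree f ->
  agree (fun x => cos (dotmul s x + theta) * f x).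
Proof.
move=> [bf fXY]; split=> [|t eta]; first exact: bounded_measurableM.
have H Z : measurable_fun [set: T] Z ->
    \int[P]_x (cos (dotmul s (Z x) + theta) * f (Z x) *
               cos (dotmul t (Z x) + eta)) =
    2^-1 * (\int[P]_x (f (Z x) * cos (dotmul (s + t) (Z x) + (theta + eta))) +
            \int[P]_x (f (Z x) * cos (dotmul (s - t) (Z x) + (theta - eta)))).
  move=> mZ; rewrite -RintegralD//; [|exact: integrable_agree..].
  rewrite -RintegralZl//; last first.
    apply: (@integrable_bounded_measurable _ _ _ P).
    apply: bounded_measurableD;
    exact: (bounded_measurable_comp (bounded_measurableM bf (bm_cos _ _))).
  apply: eq_Rintegral => x _; rewrite dotmulDl dotmulBl.
  set a := dotmul s _; set b := dotmul t _.
  rewrite (_ : a + b + _ = (a + theta) + (b + eta)); last by ring.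
  rewrite (_ : a - b + _ = (a + theta) - (b + eta)); last by ring.
  by rewrite (cosD (a + theta)) (cosB (a + theta)); field.
by rewrite !H// !fXY.
Qed.

Let multiplier_cos s theta : multiplier (fun x => cos (dotmul s x + theta)).
Proof. by split=> [|f]; [exact: bm_cos|exact: agree_cos]. Qed.

Let multiplier_cst c : multiplier (fun=> c).
Proof. by split=> [|f]; [exact: bounded_measurable_cst|exact: agreeZ]. Qed.

Let multiplierM g h : multiplier g -> multiplier h ->
  multiplier (fun x => g x * h x).
Proof.
move=> [bg gA] [bh hA]; split=> [|f af]; first exact: bounded_measurableM.
rewrite (_ : (fun x => _) = fun x => g x * (h x * f x)).
  exact/gA/hA.
by apply/funext => x; rewrite mulrA.
Qed.

Let multiplierD g h : multiplier g -> multiplier h ->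
  multiplier (fun x => g x + h x).
Proof.
move=> [bg gA] [bh hA]; split=> [|f af]; first exact: bounded_measurableD.
rewrite (_ : (fun x => _) = fun x => g x * f x + h x * f x).
  by apply: agreeD; [exact: gA|exact: hA].
by apply/funext => x; rewrite mulrDl.
Qed.

Let multiplierB g h : multiplier g -> multiplier h ->
  multiplier (fun x => g x - h x).
Proof.
move=> bg bh; rewrite (_ : (fun x => _) = fun x => g x + (-1) * h x).
  exact/multiplierD/multiplierM.
by apply/funext => x; rewrite mulN1r.
Qed.

Let multiplierX h k : multiplier h -> multiplier (fun x => h x ^+ k).
Proof.
move=> bh; elim: k => [|k ih].
  by rewrite (_ : (fun x => _) = fun=> 1).
rewrite (_ : (fun x => _) = fun x => h x * h x ^+ k); first exact: multiplierM.
by apply/funext => x; rewrite exprS.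
Qed.

Let multiplier_limit (h_ : ('cV[R]_n -> R)^nat) h M :
  (forall k, multiplier (h_ k)) -> (forall k x, `|h_ k x| <= M) ->
  (forall x, h_ ^~ x @ \oo --> h x) -> multiplier h.
Proof.
move=> mh hM ch; have bh k : bounded_measurable (h_ k) by case: (mh k).
split=> [|f af]; first exact: bounded_measurable_limit bh hM ch.
have [_ [N fN]] := af.1.
apply: (@agree_limit (fun k x => h_ k x * f x) _ (M * N)) => [k|k x|x].
- by case: (mh k) => _; apply.
- by rewrite normrM ler_pM.
- by apply: cvgM; [exact: ch|exact: cvg_cst].
Qed.

(** A sine is a cosine with shifted phase, so polynomials in it are multipliers. Two bounded limits
    follow: [step_poly] gives the positive part, and [cvg_onem_expr] turns that into the
    indicator. *)
Let multiplier_sin_gt0 s theta :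
  multiplier (fun x => (0 < sin (dotmul s x + theta))%R%:R).
Proof.
have sin1 (z : R) : `|sin z| <= 1 by rewrite ler_norml sin_geN1 sin_le1.
have mu : multiplier (fun x => sin (dotmul s x + theta)).
  rewrite (_ : (fun x => _) = fun x => cos (dotmul s x + (theta - pi / 2))) //.
  by apply/funext => x; rewrite addrA cosB cos_pihalf sin_pihalf mulr0 mulr1 add0r.
have mup : multiplier (fun x => Num.max (sin (dotmul s x + theta)) 0).
  apply: (@multiplier_limit
    (fun k x => step_poly k (sin (dotmul s x + theta))) _ 1).
  - move=> k; rewrite /step_poly; apply: multiplierM => //.
    apply/multiplierX/multiplierB => //; apply/multiplierX/multiplierM => //.
    exact: multiplierB.
  - by move=> k x; exact: normr_step_poly.
  - by move=> x; exact: cvg_step_poly.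
have max01 (z : R) : 0 <= Num.max (sin z) 0 <= 1.
  by rewrite le_max lexx orbT ge_max sin_le1 ler01.
apply: (@multiplier_limit
  (fun k x => 1 - (1 - Num.max (sin (dotmul s x + theta)) 0) ^+ k) _ 1).
- by move=> k; apply/multiplierB/multiplierX/multiplierB.
- move=> k x; set m := Num.max _ _.
  have /andP[m0 m1] := max01 (dotmul s x + theta).
  by rewrite ger0_norm ?gerBl ?subr_ge0 ?exprn_ge0 ?exprn_ile1 ?subr_ge0 ?gerBl.
- move=> x; have := cvg_onem_expr (max01 (dotmul s x + theta)).
  by rewrite lt_max ltxx orbF.
Qed.

(** The set where [sin ((x i ord0 - a) / k.+1%:R)] is positive is a union of slabs. As the period
    grows with [k], the slab starting at [a] fills the half-space and the others move off to
    infinity. *)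
Let multiplier_gt i a : multiplier (fun x => (a < x i ord0)%R%:R).
Proof.
apply: (@multiplier_limit
  (fun k x => (0 < sin ((x i ord0 - a) / k.+1%:R))%R%:R) _ 1).
- move=> k; rewrite (_ : (fun x => _) = fun x : 'cV[R]_n =>
    (0 < sin (dotmul (k.+1%:R^-1 *: delta_mx i ord0) x + - a / k.+1%:R))%R%:R) //.
  apply/funext => x; rewrite dotmulZl dotmul_delta; congr ((0 < sin _)%R%:R).
  by rewrite mulrBl mulrC mulNr.
- by move=> k x; rewrite ger0_norm// lern1 leq_b1.
- by move=> x; rewrite -subr_gt0; exact: cvg_sin_gt0.
Qed.

Let sigma_algebra_multiplier : sigma_algebra [set: 'cV[R]_n]
  [set B : set 'cV[R]_n | multiplier (\1_B : _ -> R)].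
Proof.
have mulC (B : set 'cV[R]_n) : multiplier (\1_B : _ -> R) ->
    multiplier (fun x => 1 - \1_B x).
  exact: multiplierB.
split => /=.
- by rewrite indic0; exact: multiplier_cst.
- move=> B mB; rewrite setTD indicC (_ : (fun x => _) = fun x => 1 - \1_B x).
    exact: mulC.
  by apply/funext => x; rewrite indicE; case: (x \in B); rewrite ?subr0 ?subrr.
(* [g k] is the indicator of the complement of the union of the first [k] sets, which may overlap;
   [1 - g k] tends to the indicator of the whole union. *)
move=> F mF; pose g k x : R := \prod_(j < k) (1 - \1_(F j) x).
have g01 k x : 0 <= g k x <= 1.
  rewrite /g; apply/andP; split.
    by apply: prodr_ge0 => j _; rewrite subr_ge0 indicE lern1 leq_b1.
  apply: prodr_ile1 => j _; rewrite subr_ge0 gerBl indicE.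
  by rewrite lern1 leq_b1 ler0n.
apply: (@multiplier_limit (fun k x => 1 - g k x) _ 1).
- move=> k; apply: multiplierB => //; rewrite /g.
  elim: k => [|k ih].
    rewrite (_ : (fun x => _) = fun=> 1) //.
    by apply/funext => x; rewrite big_ord0.
  rewrite (_ : (fun x => _) =
    fun x => \prod_(j < k) (1 - \1_(F j) x) * (1 - \1_(F k) x)).
    exact/multiplierM/mulC.
  by apply/funext => x; rewrite big_ord_recr.
- move=> k x; have /andP[g0 g1] := g01 k x.
  by rewrite ger0_norm ?subr_ge0// gerBl.
- move=> x; have [[j _ Fjx]|nFx] := pselect ((\bigcup_i F i) x).
    apply: cvg_near_cst; exists j.+1 => // k /= jk.
    rewrite indicE mem_set; last by exists j.
    rewrite /g (bigD1 (Ordinal jk))//= indicE mem_set// subrr mul0r.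
    by rewrite subr0.
  rewrite indicE memNset// (_ : (fun k => _) = cst 0); first exact: cvg_cst.
  apply/funext => k; rewrite /g big1 ?subrr// => j _.
  by rewrite indicE memNset ?subr0// => Fjx; apply: nFx; exists j.
Qed.

Let multiplier_measurable (A : set 'cV[R]_n) : measurable A ->
  multiplier (\1_A : _ -> R).
Proof.
move: A; change (g_sigma_preimage (fun i (x : 'cV[R]_n) => x i ord0) `<=`
  [set B : set 'cV[R]_n | multiplier (\1_B : _ -> R)]).
apply: smallest_sub; first exact: sigma_algebra_multiplier.
rewrite -bigcup_seq; apply: bigcup_sub => i _ _ [B mB <-]; rewrite setTI.
(* The real sets whose preimage under coordinate [i] has a multiplier as indicator form a
   sigma-algebra. It remains to see that it contains the open rays to the right, which generate the
   Borel sets. *)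
have sB := sigma_algebra_image (fun x : 'cV[R]_n => x i ord0) sigma_algebra_multiplier.
suff : measurable `<=` image_set_system [set: 'cV[R]_n]
    (fun x => x i ord0) [set B | multiplier (\1_B : _ -> R)].
  by move=> /(_ B mB) /=; rewrite /image_set_system/= setTI.
rewrite [X in X `<=` _](RGenOInfty.measurableE R).
apply: smallest_sub => // _ [a ->]; rewrite /image_set_system/= setTI.
rewrite (_ : \1_ _ = fun x : 'cV[R]_n => (a < x i ord0)%R%:R) //.
apply/funext => x; rewrite indicE; congr (nat_of_bool _)%:R.
by apply/idP/idP; rewrite inE/= in_itv/= andbT.
Qed.

(** The phase [theta] makes the cosines carry both the real and the imaginary part of the
    characteristic function. The hypothesis puts the constant 1 in [agree]; multiplying it by the
    indicator of [A], at frequency and phase 0, gives the probabilities of [A]. *)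
Lemma eq_in_law_cos :
  (forall s theta, \int[P]_x cos (dotmul s (X x) + theta) =
                   \int[P]_x cos (dotmul s (Y x) + theta)) ->
  eq_in_law P X Y.
Proof.
move=> XY A mA.
have agree1 : agree (fun=> 1).
  split=> [|s theta]; first exact: bounded_measurable_cst.
  under eq_Rintegral do rewrite mul1r.
  by rewrite XY; apply: eq_Rintegral => x _; rewrite mul1r.
have [_ /(_ _ agree1)[_ /(_ 0 0)]] := multiplier_measurable mA.
have H Z : measurable_fun [set: T] Z ->
    \int[P]_x (\1_A (Z x) * 1 * cos (dotmul 0 (Z x) + 0)) = fine (P (Z @^-1` A)).
  move=> mZ; under eq_Rintegral do rewrite dotmul0l addr0 cos0 !mulr1.
  rewrite /Rintegral (_ : (fun x => _) = (fun x => (\1_(Z @^-1` A) x)%:E)) //.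
  by rewrite integral_indic ?setIT// -[X in measurable X]setTI; exact: mZ.
have fin_numZ Z : measurable_fun [set: T] Z -> P (Z @^-1` A) \is a fin_num.
  by move=> mZ; rewrite fin_num_measure// -[X in measurable X]setTI; exact: mZ.
by rewrite !H// => PXY; rewrite -[LHS]fineK ?PXY ?fineK ?fin_numZ.
Qed.

End uniqueness.

(** * Reflections *)

Section householder.
Context (R : realType) (n : nat).
Implicit Types s t u v : 'cV[R]_n.

(** Reflection in the hyperplane orthogonal to [v]; for [v = 0] it is the identity. *)
Definition reflection v t : 'cV[R]_n := t - (2 * dotmul v t / dotmul v v) *: v.

Definition householder v : 'M[R]_n := 1%:M - (2 / dotmul v v) *: (v *m v^T).

Lemma tr_householder v : (householder v)^T = householder v.
Proof. by rewrite /householder linearB/= linearZ/= trmx1 trmx_mul trmxK. Qed.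

Lemma mulmx_householder v t : householder v *m t = reflection v t.
Proof.
rewrite /householder mulmxBl mul1mx -scalemxAl -mulmxA [v^T *m t]mx11_scalar.
rewrite -/(dotmul v t) -[v in v *m _]mulmx1 mul_mx_scalar scalerA mulmx1.
by rewrite mulrAC.
Qed.

Lemma reflectionK v : v != 0 -> involutive (reflection v).
Proof.
rewrite -dotmul_eq0 => v0 t; rewrite /reflection dotmulBr dotmulZr.
rewrite -addrA -opprD -scalerDl [X in X *: v](_ : _ = 0) ?scale0r ?subr0//.
by field.
Qed.

(** The matrix is symmetric, so orthogonality means that its square is the identity; this is
    [reflectionK], read off column by column on the standard basis. *)
Lemma orthogonal_householder v : v != 0 -> orthogonal_mx (householder v).
Proof.
move=> v0; rewrite /orthogonal_mx tr_householder; apply/matrixP => i j.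
have : householder v *m (householder v *m delta_mx j (@ord0 0)) =
    1%:M *m delta_mx j (@ord0 0).
  by rewrite !mulmx_householder reflectionK// mul1mx.
rewrite mulmxA.
by move/matrixP => /(_ i ord0); rewrite -!colE !mxE.
Qed.

Lemma reflection_self t : reflection t t = - t.
Proof.
have [->|t0] := eqVneq t 0; first by rewrite /reflection scaler0 subr0 oppr0.
rewrite /reflection mulfK ?dotmul_eq0// scaler_nat mulr2n opprD addrA.
by rewrite subrr sub0r.
Qed.

(** For vectors of equal length, the hyperplane through 0 orthogonal to [t - s] is the perpendicular
    bisector of [s] and [t]. *)
Lemma reflectionB s t : dotmul s s = dotmul t t -> s != t ->
  reflection (t - s) t = s.
Proof.
move=> st; rewrite eq_sym -subr_eq0 -dotmul_eq0 => ts0; rewrite /reflection.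
suff -> : 2 * dotmul (t - s) t = dotmul (t - s) (t - s).
  by rewrite divff// scale1r opprB addrC subrK.
by rewrite !(dotmulBl, dotmulBr) st (dotmulC t s); ring.
Qed.

Lemma orthogonal_dotmul (H : 'M[R]_n) t : orthogonal_mx H ->
  dotmul (H^T *m t) (H^T *m t) = dotmul t t.
Proof.
(* For square matrices a left inverse is a right inverse, so [H *m H^T] is the identity too. *)
move=> /mulmx1C HH; rewrite dotmul_tr trmxK mulmxA.
by rewrite HH mul1mx.
Qed.

End householder.

(** * Characteristic functions and spherical symmetry *)

Section affine.
Context (R : realType) (n : nat).

Lemma measurable_affine (H : 'M[R]_n) (a : 'cV[R]_n) :
  measurable_fun [set: 'cV[R]_n] (fun x => H *m x + a).
Proof.
apply/measurable_fun_coordP => i.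
rewrite (_ : (fun x => _) =
    fun x : 'cV[R]_n => \sum_j H i j * x j ord0 + a i ord0).
  apply: measurable_funD => //; apply: measurable_sum => j.
  by apply: measurable_funM => //; exact: measurable_coord.
by apply/funext => x; rewrite !mxE.
Qed.

Lemma measurable_translate (mu : 'cV[R]_n) :
  measurable_fun [set: 'cV[R]_n] (fun x => x - mu).
Proof.
rewrite (_ : (fun x => _) = fun x => 1%:M *m x + (- mu)).
  exact: measurable_affine.
by apply/funext => x; rewrite mul1mx.
Qed.

Lemma measurable_translateN (mu : 'cV[R]_n) :
  measurable_fun [set: 'cV[R]_n] (fun x => mu - x).
Proof.
rewrite (_ : (fun x => _) = fun x => - 1%:M *m x + mu).
  exact: measurable_affine.
by apply/funext => x; rewrite mulNmx mul1mx addrC.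
Qed.

Lemma measurable_mul_translate (H : 'M[R]_n) (mu : 'cV[R]_n) :
  measurable_fun [set: 'cV[R]_n] (fun x => H *m (x - mu)).
Proof.
rewrite (_ : (fun x => _) = fun x => H *m x + (- (H *m mu))).
  exact: measurable_affine.
by apply/funext => x; rewrite mulmxBr.
Qed.

End affine.

Section characteristic_function.
Context (R : realType) (n : nat) (P : probability 'cV[R]_n R) (mu : 'cV[R]_n).
Implicit Types s t : 'cV[R]_n.

(** [cos_transform] and [sin_transform] are the real and imaginary parts of the characteristic
    function of [X - mu]. *)
Definition cos_transform t : R := \int[P]_x cos (dotmul t (x - mu)).

Definition sin_transform t : R := \int[P]_x sin (dotmul t (x - mu)).

Lemma bounded_measurable_cos_translate t :
  bounded_measurable (fun x : 'cV[R]_n => cos (dotmul t (x - mu))).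
Proof.
apply/bounded_measurable_cos/(measurableT_comp (measurable_dotmul t)).
exact: measurable_translate.
Qed.

Lemma bounded_measurable_sin_translate t :
  bounded_measurable (fun x : 'cV[R]_n => sin (dotmul t (x - mu))).
Proof.
apply/bounded_measurable_sin/(measurableT_comp (measurable_dotmul t)).
exact: measurable_translate.
Qed.

Lemma cos_transformN t : cos_transform (- t) = cos_transform t.
Proof. by apply: eq_Rintegral => x _; rewrite dotmulNl cosN. Qed.

(** Sine is odd, so exchanging [X - mu] and [mu - X] shows that the integral is its own opposite. *)
Lemma symmetric_sin_transform t : symmetric_about P mu -> sin_transform t = 0.
Proof.
move=> symP.
have bs : bounded_measurable (fun x : 'cV[R]_n => sin (dotmul t x)).
  by apply/bounded_measurable_sin; exact: measurable_dotmul.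
have := eq_in_law_Rintegral (measurable_translate mu)
  (measurable_translateN mu) symP bs.
rewrite -/(sin_transform t) [RHS](_ : _ = - sin_transform t).
  by move=> /eqP; rewrite -subr_eq0 opprK -mulr2n mulrn_eq0 => /orP[//|/eqP].
rewrite -mulN1r -RintegralZl//; last first.
  exact/integrable_bounded_measurable/bounded_measurable_sin_translate.
by apply: eq_Rintegral => x _; rewrite -opprB dotmulNr sinN mulN1r.
Qed.

(** In the addition formula for cosine the sine term integrates to 0. Hence [eq_in_law_cos] can be
    checked on [cos_transform] alone. *)
Lemma Rintegral_cosD s theta : sin_transform s = 0 ->
  \int[P]_x cos (dotmul s (x - mu) + theta) = cos_transform s * cos theta.
Proof.
move=> s0.
rewrite -[RHS]subr0 -[X in _ - X](mul0r (sin theta)) -s0 -!RintegralZr//;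
  [|apply: integrable_bounded_measurable; exact: bounded_measurable_sin_translate
  |apply: integrable_bounded_measurable; exact: bounded_measurable_cos_translate].
rewrite -RintegralB//; last 2 first.
- apply: (@integrable_bounded_measurable _ _ _ P).
  exact/bounded_measurableM/bounded_measurable_cst/bounded_measurable_cos_translate.
- apply: (@integrable_bounded_measurable _ _ _ P).
  exact/bounded_measurableM/bounded_measurable_cst/bounded_measurable_sin_translate.
by apply: eq_Rintegral => x _; rewrite cosD.
Qed.

(** Moving [H] across the dot product, the transform of [H *m (X - mu)] at [t] is that of [X - mu]
    at [H^T *m t]. The converse is uniqueness. *)
Lemma spherically_symmetric_cos_transform : (forall t, sin_transform t = 0) ->
  spherically_symmetric_about P mu <->
  forall H : 'M[R]_n, orthogonal_mx H -> forall t,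
    cos_transform (H^T *m t) = cos_transform t.
Proof.
move=> sin0.
split=> [sphP H oH t|cosH H oH]; last first.
  apply: eq_in_law_cos => [||s theta].
  - exact: measurable_mul_translate.
  - exact: measurable_translate.
  - under eq_Rintegral do rewrite dotmul_tr.
    by rewrite !Rintegral_cosD// cosH.
have bc : bounded_measurable (fun x : 'cV[R]_n => cos (dotmul t x)).
  by apply/bounded_measurable_cos; exact: measurable_dotmul.
have := eq_in_law_Rintegral (measurable_mul_translate H mu)
  (measurable_translate mu) (sphP H oH) bc.
by under eq_Rintegral do rewrite dotmul_tr.
Qed.

(** The constant 1 dominates the integrand. Continuity of the path is asked of its dot products,
    since the integrand sees nothing else. *)
Lemma continuous_cos_transform (g : R -> 'cV[R]_n) (a b : R) :
  (forall y, {in `]a, b[%classic, continuous (fun r => dotmul (g r) y)}) ->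
  {in `]a, b[%classic, continuous (fun r => cos_transform (g r))}.
Proof.
move=> cg; apply: (@continuity_under_integral _ _ _ P
  (fun r x => cos (dotmul (g r) (x - mu))) setT measurableT a b _ _ (cst 1)).
- by move=> r _; exact/integrable_bounded_measurable/bounded_measurable_cos_translate.
- apply: aeW => x _ r rab; apply: continuous_comp; first exact: cg.
  exact: continuous_cos.
- apply: (@integrable_bounded_measurable _ _ _ P (cst 1)).
  exact: bounded_measurable_cst.
- by move=> r _; apply: aeW => x _; exact: cos_max.
Qed.

(* The reflections of t along the vectors t - r *: s move continuously on the
   sphere from - t to s as r runs through [0, 1]. *)
Lemma cos_transform_sphere :
  (forall H : 'M[R]_n, orthogonal_mx H -> forall t,
    cos_transform (H^T *m t) ^+ 2 = cos_transform t ^+ 2) ->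
  forall s t, dotmul s s = dotmul t t -> cos_transform s = cos_transform t.
Proof.
move=> sqr_inv s t st; have [->//|sNt] := eqVneq s t.
pose v r := t - r *: s; pose g r := reflection (v r) t.
(* If [t = r *: s] with equal lengths and [s != t], then [r = -1]. The interval is open, contains
   [[0, 1]] and excludes that value. *)
have v_neq0 (r : R) : r \in `]-1, 2[%classic -> v r != 0.
  rewrite inE/= in_itv/= => /andP[r1 _]; apply/eqP => /eqP.
  rewrite subr_eq0 => /eqP trs.
  have s0 : dotmul s s != 0.
    by apply: contra sNt; rewrite dotmul_eq0 trs => /eqP ->; rewrite scaler0.
  have : (r + 1) * (r - 1) * dotmul s s = 0.
    rewrite (_ : _ * _ = r * (r * dotmul s s) - dotmul s s); last by ring.
    by apply/eqP; rewrite subr_eq0 [X in _ == X]st trs dotmulZl dotmulZr.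
  move=> /eqP; rewrite !mulf_eq0 (negbTE s0) orbF.
  move=> /orP[/eqP|/eqP] rE; first by lra.
  by move/eqP : sNt; apply; rewrite trs (_ : r = 1) ?scale1r//; lra.
have g_sqr (r : R) : r \in `]-1, 2[%classic ->
    cos_transform (g r) ^+ 2 = cos_transform t ^+ 2.
  move=> /v_neq0 v0; rewrite /g -mulmx_householder -tr_householder.
  exact/sqr_inv/orthogonal_householder.
have cg : {in `]-1, 2[%classic, continuous (fun r => cos_transform (g r))}.
  apply: continuous_cos_transform => y r /v_neq0; rewrite -dotmul_eq0 => v0.
  (* Expanded, this is a rational function of [r] whose denominator is [dotmul (v r) (v r)]. *)
  have gE : (fun r => dotmul (g r) y) = fun r => dotmul t y -
    2 * (dotmul t t - r * dotmul s t) /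
    (dotmul t t - 2 * r * dotmul s t + r ^+ 2 * dotmul s s) *
    (dotmul t y - r * dotmul s y).
    apply/funext => r'; rewrite /g /reflection /v.
    rewrite !(dotmulBl, dotmulZl, dotmulBr, dotmulZr).
    rewrite (dotmulC t s); congr (_ - 2 * _ / _ * _); ring.
  have linear_cvg a b : (a - x * b : R) @[x --> r] --> a - r * b.
    by apply: cvgB; [exact: cvg_cst|apply: cvgM; [exact: cvg_id|exact: cvg_cst]].
  rewrite gE; apply: cvgB; first exact: cvg_cst.
  apply: cvgM; last exact: linear_cvg.
  apply: cvgM; first by apply: cvgM; [exact: cvg_cst|exact: linear_cvg].
  apply: cvgV.
    move: v0; rewrite /v !(dotmulBl, dotmulZl, dotmulBr, dotmulZr) (dotmulC t s).
    by apply: contra => /eqP <-; apply/eqP; ring.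
  apply: cvgD.
    apply: cvgB; first exact: cvg_cst.
    apply: cvgM; last exact: cvg_cst.
    by apply: cvgM; [exact: cvg_cst|exact: cvg_id].
  by apply: cvgM; [rewrite expr2; apply: cvgM; exact: cvg_id|exact: cvg_cst].
have inI (r : R) : 0 <= r <= 1 -> r \in `]-1, 2[%classic.
  by move=> /andP[r0 r1]; rewrite inE/= in_itv/=; apply/andP; split; lra.
have g0 : cos_transform (g 0) = cos_transform t.
  by rewrite /g /v scale0r subr0 reflection_self cos_transformN.
have g1 : cos_transform (g 1) = cos_transform s.
  by rewrite /g /v scale1r reflectionB.
(* The values at [s] and [t] agree up to sign. If they are opposite, the intermediate value theorem
   gives a zero along the path; the square being constant there, both values are 0. *)
have := g_sqr 1 (inI 1 _); rewrite lexx ler01 g1 => /(_ isT)/eqP.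
rewrite eqf_sqr => /orP[/eqP//|/eqP sNtE].
have cG : {within `[0, 1]%classic, continuous (fun r => cos_transform (g r))}.
  apply: continuous_in_subspaceT => r; rewrite inE/= in_itv/= => r01.
  exact/cg/inI.
have [|c c01 gc0] := @IVT _ (fun r => cos_transform (g r)) 0 1 0 ler01 cG.
  rewrite g0 g1 sNtE ge_min le_max oppr_le0 oppr_ge0.
  by case: (leP 0 (cos_transform t)) => [_|/ltW ->]; rewrite ?orbT.
rewrite in_itv/= in c01; have := g_sqr c (inI c c01); rewrite gc0 => /esym/eqP.
by rewrite expr0n/= sqrf_eq0 sNtE => /eqP ->; rewrite oppr0.
Qed.

End characteristic_function.

(** * The characteristic function of the difference of two independent copies *)

Section difference.
Context (R : realType) (n : nat) (P : probability 'cV[R]_n R) (mu : 'cV[R]_n).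
Context (disp : measure_display) (T : measurableType disp).
Variable Pr : probability T R.
Variables (X1 X2 : {RV Pr >-> 'cV[R]_n}).
Hypotheses (X1P : has_law X1 P) (X2P : has_law X2 P).
Hypothesis indX : independent_rv X1 X2.

Let D : probability 'cV[R]_n R := distribution Pr (rv_sub X1 X2).

Let RintegralM (f g : 'cV[R]_n -> R) :
  bounded_measurable f -> bounded_measurable g ->
  \int[Pr]_x (f (X1 x) * g (X2 x)) = \int[P]_y f y * \int[P]_y g y.
Proof.
by move=> bf bg; rewrite independent_Rintegral// (has_law_Rintegral X1P)//
  (has_law_Rintegral X2P).
Qed.

Let integrableM (f g : 'cV[R]_n -> R) :
  bounded_measurable f -> bounded_measurable g ->
  Pr.-integrable [set: T] (EFin \o (fun x => f (X1 x) * g (X2 x))).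
Proof.
move=> bf bg; apply: integrable_bounded_measurable.
by apply: bounded_measurableM; exact: bounded_measurable_comp.
Qed.

Let bcos := bounded_measurable_cos_translate mu.
Let bsin := bounded_measurable_sin_translate mu.

(** As [X1 - X2] is the difference of the two centred copies, independence makes its characteristic
    function the squared modulus of that of [X - mu]. *)
Lemma cos_transform_difference t : cos_transform D 0 t =
  cos_transform P mu t ^+ 2 + sin_transform P mu t ^+ 2.
Proof.
rewrite /cos_transform distribution_Rintegral; last first.
  exact: bounded_measurable_cos_translate.
rewrite !expr2 -!RintegralM// -RintegralD//; last 2 first.
- exact: (integrableM (bcos t) (bcos t)).
- exact: (integrableM (bsin t) (bsin t)).
apply: eq_Rintegral => x _; rewrite subr0 -cosB -dotmulBr.
by rewrite opprB addrA subrK.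
Qed.

(** By independence and the common law, the two products in the formula for the sine of a difference
    have the same expectation. *)
Lemma sin_transform_difference t : sin_transform D 0 t = 0.
Proof.
rewrite /sin_transform distribution_Rintegral; last first.
  exact: bounded_measurable_sin_translate.
transitivity (\int[Pr]_x
    (sin (dotmul t (X1 x - mu)) * cos (dotmul t (X2 x - mu)) -
     cos (dotmul t (X1 x - mu)) * sin (dotmul t (X2 x - mu)))).
  apply: eq_Rintegral => x _; rewrite subr0 -sinB -dotmulBr.
  by rewrite opprB addrA subrK.
rewrite RintegralB//; last 2 first.
- exact: (integrableM (bsin t) (bcos t)).
- exact: (integrableM (bcos t) (bsin t)).
rewrite (RintegralM (bsin t) (bcos t)) (RintegralM (bcos t) (bsin t)).
by rewrite mulrC subrr.
Qed.

End difference.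

Theorem lemma6p1 (R : realType) (d : nat) (hd : (2 <= d)%N)
    (P : probability 'cV[R]_d R) (mu : 'cV[R]_d)
    (disp : measure_display) (T : measurableType disp) (Pr : probability T R)
    (X1 X2 : {RV Pr >-> 'cV[R]_d})
    (hX1 : has_law X1 P) (hX2 : has_law X2 P)
    (hind : independent_rv X1 X2)
    (hsym : symmetric_about P mu) :
  spherically_symmetric_about P mu <->
  spherically_symmetric_about (distribution Pr (rv_sub X1 X2)) 0.
Proof.
have sin0 t : sin_transform P mu t = 0 by exact: symmetric_sin_transform.
have cosD t : cos_transform (distribution Pr (rv_sub X1 X2)) 0 t =
    cos_transform P mu t ^+ 2.
  by rewrite (cos_transform_difference mu hX1 hX2 hind) sin0 expr0n addr0.
have [PH HP] := spherically_symmetric_cos_transform sin0.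
have [DH HD] := spherically_symmetric_cos_transform
  (sin_transform_difference mu hX1 hX2 hind).
split=> [/PH cosH|/DH cosH].
  by apply: HD => H oH t; rewrite !cosD cosH.
(* Invariance of the transform of the difference is invariance of the square; the continuity
   argument on spheres removes the square, as [H^T *m t] and [t] have equal length. *)
apply: HP => H oH t; apply: cos_transform_sphere; last exact: orthogonal_dotmul.
by move=> K oK u; rewrite -!cosD cosH.
Qed.
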